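(* Let $q_n$ denote the $n$th prime number. For any $\delta\in\mathbb{Z}$ with $\delta\ge 3$, there exist infinitely many primitive covering numbers of the form $2^{\beta}q_kq_{k+1}$, where $k\ge 1$ and $\beta\ge 0$ are integers with $\beta\le q_k-3$. Consequently, each such primitive covering number fails to satisfy Sun's condition, that is, it cannot be written as $p_1^{a_1}\cdots p_r^{a_r}$ with $p_1,\dots,p_r$ distinct primes (in any order) and $a_1,\dots,a_r$ positive integers such that $$\prod_{0<t<s}(a_t+1)\ \ge\ p_s-1+\delta_{r,s}\qquad\text{for all } s=1,2,\dots,r,$$ where $\delta_{r,s}$ is Kronecker's delta and the empty product is $1$; thus each such number is a counterexample to the conjecture of Sun that every primitive covering number can be written in this way.
   Context: A covering is a finite collection of congruences $z\equiv x_i\pmod{m_i}$, with integers $x_i\ge 0$, $m_i\ge 2$, such that every integer satisfies at least one of the congruences; the moduli $m_i$ are assumed pairwise distinct. A positive integer $L$ is a covering number if there exists a covering whose moduli are distinct divisors $d>1$ of $L$. A covering number $L$ is a primitive covering number if no proper divisor of $L$ is a covering number. Sun's conjecture: any primitive covering number can be written as $p_1^{a_1}\cdots p_r^{a_r}$, where $p_1,\dots,p_r$ are distinct primes and $a_1,\dots,a_r$ are positive integers satisfying the displayed inequalities. (The symbol $\delta_{r,s}$ is Kronecker's delta and is unrelated to the integer $\delta$.) *)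

(* Defs.v *)
From mathcomp Require Import all_boot all_order all_algebra.
From mathcomp Require Import all_classical.

Set Implicit Arguments.
Unset Strict Implicit.
Unset Printing Implicit Defensive.

Lemma exists_prime_above (m : nat) : exists p, (m < p) && prime p.
Proof. by have [p mp pp] := prime_above m; exists p; rewrite mp pp. Qed.

Definition next_prime (m : nat) : nat := ex_minn (exists_prime_above m).

(* Indexed from 1: nth_prime 1 = 2; the value nth_prime 0 = 0 is junk. *)
Definition nth_prime (n : nat) : nat := iter n next_prime 0.

(* The pair (x, m) stands for the congruence z = x (mod m). *)
Definition is_covering (C : seq (nat * nat)) : Prop :=
  [/\ forall c, c \in C -> 2 <= c.2,
      uniq [seq c.2 | c <- C]
    & forall z : int, exists2 c, c \in C & (z = c.1%:Z %[mod c.2%:Z])%Z].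

Definition covering_number (L : nat) : Prop :=
  0 < L /\
  exists2 C, is_covering C & forall c, c \in C -> 1 < c.2 /\ c.2 %| L.

Definition primitive_covering_number (L : nat) : Prop :=
  covering_number L /\
  forall d, d %| L -> d != L -> ~ covering_number d.

(* Indices run over 0, ..., r-1 instead of 1, ..., r, so the last index s is
   the one with s.+1 = r; the boolean (s.+1 == r) is Kronecker's delta. The
   truncated subtraction is exact because p s is prime. *)
Definition sun_condition (L : nat) : Prop :=
  exists (r : nat) (p a : 'I_r -> nat),
    [/\ injective p,
        forall i, prime (p i) /\ 0 < a i,
        L = \prod_(i < r) p i ^ a i
      & forall s : 'I_r,
          p s - 1 + (s.+1 == r) <= \prod_(t < r | t < s) (a t + 1)].

Definition sun_conjecture : Prop :=
  forall L, primitive_covering_number L -> sun_condition L.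

(* The bound b <= q_k - 3 is between integers; it is written additively since
   truncated subtraction would admit b = 0 when q_k = 2. *)
Definition special_form (L : nat) : Prop :=
  exists k b : nat,
    [/\ 1 <= k, b + 3 <= nth_prime k
      & L = 2 ^ b * nth_prime k * nth_prime k.+1].

(* Main.v *)
Require Import Defs.
From mathcomp Require Import all_boot all_order all_algebra.
From mathcomp Require Import all_classical.
From mathcomp Require Import zify.

(* For primes 2 < p < q, after the moduli 2^i (1 <= i <= b) only the class of
   0 mod 2^b is left, and inside it the moduli 2^i p, 2^i q, 2^i p q (i <= b)
   behave like columns, rows and cells of a p x q grid: b+1 of each suffice when
   (p-b-1)(q-b-1) <= b+1. With b = p-3 this reads 2(q-p+2) <= p-2, which holds
   for infinitely many consecutive primes, for otherwise the primes would grow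
   geometrically. Taking b minimal gives a primitive covering number, since
   2^b p and 2^b q are not covering numbers when b+1 < p. *)

(** * Coverings as a choice of residues *)

Lemma uniq_map_inj (T U : eqType) (f : T -> U) (s : seq T) :
  uniq [seq f x | x <- s] -> {in s &, injective f}.
Proof.
move=> fs x y xs ys fxy; rewrite -(nth_index x xs) -(nth_index x ys).
congr nth; apply: (uniqP (f x) fs); rewrite ?inE ?size_map ?index_mem //.
by rewrite !(nth_map x) ?index_mem // !nth_index.
Qed.

Lemma covering_numberP (L : nat) :
  covering_number L <->
  0 < L /\ exists x : nat -> nat,
    forall z, exists d, [/\ 1 < d, d %| L & z = x d %[mod d]].
Proof.
split=> [[L0 [C [_ Cuniq Ccov] CL]]|[L0 [x xP]]]; split=> //.
  (* A divisor that is not a modulus of [C] gets the default residue 0. *)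
  exists (fun d => (nth (0, 0) C (index d [seq c.2 | c <- C])).1) => z.
  have [c cC zc] := Ccov z.
  have [c1 cL] := CL c cC.
  exists c.2; split=> //.
  rewrite nth_index_map //; last exact: uniq_map_inj.
  by move: zc; rewrite !modz_nat => -[].
exists [seq (x d, d) | d <- divisors L & 1 < d]; last first.
  by move=> c /mapP[d]; rewrite mem_filter -dvdn_divisors // => /andP[d1 dL] ->.
split.
- by move=> c /mapP[d]; rewrite mem_filter => /andP[d1 _] ->.
- by rewrite -map_comp map_id filter_uniq // divisors_uniq.
- move=> z.
  have zL : (0 <= (z %% L%:Z)%Z)%R by apply: modz_ge0; lia.
  have [d [d1 dL zd]] := xP `|(z %% L%:Z)%Z|%N.
  exists (x d, d) => /=.
    by apply: map_f; rewrite mem_filter d1 -dvdn_divisors.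
  rewrite modz_nat -zd -modz_nat gez0_abs //.
  have [e ->] := dvdnP dL.
  by rewrite {1}(divz_eq z (e * d)%N%:Z) PoszM GRing.mulrA modzMDl.
Qed.

Lemma covering_number_dvd (d L : nat) :
  0 < L -> d %| L -> covering_number d -> covering_number L.
Proof.
move=> L0 dL [_ [C Ccov CL]]; split=> //; exists C => // c /CL[c1 cd].
by split=> //; apply: dvdn_trans dL.
Qed.

(** * Numbers [2^b p] that are not covering numbers *)

Lemma avoid_pow2_classes (x : nat -> nat) (b : nat) :
  exists a, forall i, 0 < i <= b -> a != x (2 ^ i) %[mod 2 ^ i].
Proof.
elim: b => [|b [a aP]]; first by exists 0 => i; lia.
have keep a' : a' = a %[mod 2 ^ b] -> forall i, 0 < i <= b ->
    a' != x (2 ^ i) %[mod 2 ^ i].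
  move=> aa' i /andP[i0 ib].
  rewrite -(modn_dvdm _ (dvdn_exp2l 2 ib)) aa' modn_dvdm ?dvdn_exp2l //.
  by apply: aP; rewrite i0 ib.
have [ax|ax] := eqVneq (a %% 2 ^ b.+1) (x (2 ^ b.+1) %% 2 ^ b.+1); last first.
  exists a => i /andP[i0]; rewrite leq_eqVlt => /orP[/eqP ->//|ib].
  by apply: keep => //; rewrite i0.
(* The class of [a] mod [2^b] has two lifts mod [2^(b+1)]; if one is removed, the other survives. *)
exists (a + 2 ^ b) => i /andP[i0]; rewrite leq_eqVlt => /orP[/eqP ->|ib].
  rewrite -ax -[X in _ != X %% _]addn0 eqn_modDl mod0n.
  by rewrite modn_small ?ltn_exp2l // -lt0n expn_gt0.
by apply: keep; rewrite ?modnDr ?i0.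
Qed.

Lemma dvdn_2pow_primeM (b p d : nat) : prime p -> d %| 2 ^ b * p ->
  exists2 i, i <= b & d = 2 ^ i \/ d = 2 ^ i * p.
Proof.
move=> pp; have [pd|pd] := boolP (p %| d).
  move: pd => /dvdnP[e ->]; rewrite dvdn_pmul2r ?prime_gt0 //.
  by move=> /(dvdn_pfactor _ _ (isT : prime 2))[i ib ->]; exists i => //; right.
rewrite Gauss_dvdl; last by rewrite coprime_sym prime_coprime.
by move=> /(dvdn_pfactor _ _ (isT : prime 2))[i ib ->]; exists i => //; left.
Qed.

(* The moduli 2^i leave a class mod 2^b uncovered, and each of the b+1 moduli
   2^i p meets it in at most one of its p classes mod 2^b p. *)
Lemma not_covering_number_2pow_primeM (b p : nat) :
  prime p -> 2 < p -> b.+1 < p -> ~ covering_number (2 ^ b * p).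
Proof.
move=> pp p2 bp /covering_numberP[_ [x xP]].
have [a aP] := avoid_pow2_classes x b.
have c2p : coprime p (2 ^ b).
  by rewrite coprime_sym coprimeXl // coprime_sym prime_coprime // gtnNdvd.
(* All [a + 2^b t] avoid the classes of the moduli [2^i], so a modulus [2^i p] must catch each; only
   its residue mod [p] is kept. *)
have hit (t : 'I_p) : exists i : 'I_b.+1,
    (a + 2 ^ b * t == x (2 ^ i * p) %[mod p]).
  have [d [d1 /(dvdn_2pow_primeM _ _ _ pp)[i ib [di|di]] td]] :=
    xP (a + 2 ^ b * t); last first.
    exists (inord i); rewrite inordK // -di; apply/eqP.
    by rewrite -(@modn_dvdm d) ?di ?dvdn_mull // -di td modn_dvdm // di dvdn_mull.
  have i0 : 0 < i by case: i di {ib} => // d1'; rewrite d1' in d1.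
  have := aP i; rewrite i0 ib => /(_ isT)/eqP; case; rewrite -di -td.
  by rewrite -modnDmr (eqP (dvdn_mulr _ _)) ?addn0 // di dvdn_exp2l.
pose f t := xchoose (hit t).
have f_inj : injective f.
  move=> t u ftu; apply/val_inj => /=.
  have := xchooseP (hit t); rewrite -/(f t) ftu -(eqP (xchooseP (hit u))) /=.
  rewrite eqn_modDl.
  wlog tu : t u ftu / (t <= u).
    by move=> W; case/orP: (leq_total t u) => tu; [|rewrite eq_sym => ?; apply/esym];
      apply: W.
  rewrite eq_sym eqn_mod_dvd ?leq_mul2l ?tu ?orbT // -mulnBr Gauss_dvdr //.
  move=> /dvdn_leq; have := ltn_ord u; lia.
have := leq_card f f_inj; rewrite !card_ord; lia.
Qed.

(** * Construction of a covering *)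

(* After the moduli 2^i only the multiples of 2^(p-3) remain; there the p-2
   moduli 2^i p leave 2 classes mod p, the p-2 moduli 2^i q leave q-p+2 classes
   mod q, and the p-2 moduli 2^i p q suffice for the remaining 2(q-p+2)
   classes mod pq. *)
Lemma covering_number_2pow_primes (p q : nat) :
  prime p -> prime q -> 2 < p -> p < q -> 2 * q + 6 <= 3 * p ->
  covering_number (2 ^ (p - 3) * p * q).
Proof.
move=> pp pq p2 ltpq small.
set b := p - 3; set w := q - p + 2.
have cpq : coprime p q by rewrite prime_coprime // dvdn_prime2 //; lia.
have c2 (i r : nat) : prime r -> 2 < r -> coprime (2 ^ i) r.
  by move=> pr r2; rewrite coprimeXl // prime_coprime // dvdn_prime2 //; lia.
have c2p i := c2 i p pp p2.
have c2q i := c2 i q pq (ltn_trans p2 ltpq).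
have c2pq i : coprime (2 ^ i) (p * q) by rewrite coprimeMr c2p c2q.
apply/covering_numberP; split; first by rewrite !muln_gt0 expn_gt0; lia.
(* [u d] and [v d] are the residues of [d] mod [p] and mod [q]. The modulus [2^i p] takes column
   [i], [2^i q] takes row [i], and [2^i p q] takes the cell obtained by writing [i] in base [w],
   shifted past the first [p - 2] columns and rows. The modulus [2^i] takes the odd multiples of
   [2^(i-1)]. *)
pose u d := if q %| d then p - 2 + logn 2 d %/ w else logn 2 d.
pose v d := if p %| d then p - 2 + logn 2 d %% w else logn 2 d.
pose x d := if (p %| d) || (q %| d)
  then chinese (2 ^ logn 2 d) (p * q) 0 (chinese p q (u d) (v d))
  else 2 ^ (logn 2 d).-1.
have qNp : (q %| p) = false by apply/negbTE; rewrite dvdn_prime2 //; lia.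
have pNq : (p %| q) = false by apply/negbTE; rewrite dvdn_prime2 //; lia.
have qN2 i : (q %| 2 ^ i) = false.
  by apply/negbTE; rewrite -prime_coprime // coprime_sym.
have pN2 i : (p %| 2 ^ i) = false.
  by apply/negbTE; rewrite -prime_coprime // coprime_sym.
have log2 i e : e %| p * q -> logn 2 (2 ^ i * e) = i.
  move=> epq; rewrite mulnC logn_Gauss ?pfactorK //.
  by apply: coprime_dvdr epq _; apply: (c2pq 1).
exists x => z.
(* If [2^b] does not divide [z], then [z] has 2-adic valuation [j < b] and is caught by the modulus
   [2^(j+1)]. *)
have [zb|zb] := boolP (2 ^ b %| z); last first.
  have z0 : 0 < z by case: z zb => [|//]; rewrite dvdn0.
  have jb : logn 2 z < b by rewrite ltnNge -pfactor_dvdn.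
  have [m m2 zE] := pfactor_coprime (isT : prime 2) z0.
  set j := logn 2 z in jb zE.
  exists (2 ^ j.+1); split.
  - by rewrite (@ltn_exp2l 2 0).
  - by rewrite -mulnA dvdn_mulr // dvdn_exp2l.
  - rewrite /x pN2 qN2 /= pfactorK //=; apply/eqP.
    have m0 : 0 < m by case: m m2 {zE}.
    rewrite zE eqn_mod_dvd; last by rewrite -[X in X <= _]mul1n leq_mul2r m0 orbT.
    rewrite -[X in _ - X]mul1n -mulnBl expnS dvdn_pmul2r ?expn_gt0 //.
    by rewrite dvdn2 oddB // -coprime2n m2.
(* For [z] divisible by [2^b], the residue 0 mod [2^i] is automatic, so only the congruence mod [e]
   matters. *)
have hit i e : i <= b -> e %| p * q -> (p %| e) || (q %| e) ->
    z = chinese p q (u (2 ^ i * e)) (v (2 ^ i * e)) %[mod e] ->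
    exists d, [/\ 1 < d, d %| 2 ^ b * p * q & z = x d %[mod d]].
  move=> ib epq pqe ze; exists (2 ^ i * e).
  have e0 : 0 < e by apply: (dvdn_gt0 _ epq); rewrite muln_gt0 !prime_gt0.
  have e1 : 1 < e.
    by case/orP: pqe => /dvdn_leq-/(_ e0); apply: leq_trans; apply: prime_gt1.
  split.
  - by apply: leq_trans e1 _; rewrite leq_pmull ?expn_gt0.
  - by rewrite -mulnA dvdn_mul ?dvdn_exp2l.
  rewrite /x log2 //.
  have -> : (p %| 2 ^ i * e) || (q %| 2 ^ i * e).
    by case/orP: pqe => h; rewrite (dvdn_mull _ h) ?orbT.
  apply/eqP; rewrite chinese_remainder; last exact: coprime_dvdr epq (c2pq i).
  apply/andP; split; apply/eqP.
    apply/eqP; rewrite (chinese_modl (c2pq i)) mod0n.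
    by apply: dvdn_trans zb; apply: dvdn_exp2l.
  by rewrite -(modn_dvdm (chinese _ _ _ _) epq) (chinese_modr (c2pq i)) modn_dvdm.
have zp : z %% p < p by rewrite ltn_mod; lia.
have zq : z %% q < q by rewrite ltn_mod; lia.
have [zpb|zpb] := leqP (z %% p) b.
  apply: (hit (z %% p) p); rewrite ?dvdn_mulr ?dvdnn //.
  by rewrite (chinese_modl cpq) /u Gauss_dvdr ?qNp 1?coprime_sym // log2 ?dvdn_mulr // modn_mod.
have [zqb|zqb] := leqP (z %% q) b.
  apply: (hit (z %% q) q); rewrite ?dvdn_mull ?dvdnn ?orbT //.
  by rewrite (chinese_modr cpq) /v Gauss_dvdr ?pNq 1?coprime_sym // log2 ?dvdn_mull // modn_mod.
have w0 : 0 < w by rewrite /w addn2.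
have zpw : z %% p - (p - 2) <= 1.
  by move: zp zpb; rewrite /b; move: (z %% p); clear; lia.
have zqw : z %% q - (p - 2) < w.
  by move: zq zqb; rewrite /b /w; move: (z %% q); clear -ltpq p2; lia.
have subK y : b < y -> p - 2 + (y - (p - 2)) = y.
  by rewrite /b; clear; lia.
(* Number of the cell of [z] in the remaining grid of 2 columns and [w] rows. *)
pose i := (z %% p - (p - 2)) * w + (z %% q - (p - 2)).
have iw : i %/ w = z %% p - (p - 2) by rewrite /i divnMDl // divn_small ?addn0.
have iw' : i %% w = z %% q - (p - 2) by rewrite /i modnMDl modn_small.
apply: (hit i (p * q)); rewrite ?(dvdn_mulr q (dvdnn p)) ?dvdnn //.
  rewrite -ltnS; apply: leq_trans (_ : 2 * w <= _).
    rewrite /i mulSn mul1n -addnS leq_add //.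
    by rewrite -{2}[w]mul1n leq_mul2r zpw orbT.
  (* [2 * w <= b + 1] is exactly the hypothesis [small]. *)
  by rewrite /w /b; clear -small ltpq p2; lia.
have pd : p %| 2 ^ i * (p * q) by rewrite dvdn_mull ?dvdn_mulr.
have qd : q %| 2 ^ i * (p * q) by rewrite mulnA dvdn_mull.
rewrite /u /v pd qd log2 // iw iw'.
rewrite !subK //.
exact: chinese_mod.
Qed.

(** * Enumeration of the primes *)

Lemma next_primeP (m : nat) :
  [/\ m < next_prime m, prime (next_prime m)
    & forall l, m < l -> prime l -> next_prime m <= l].
Proof.
rewrite /next_prime; case: ex_minnP => l /andP[ml pl] lmin; split=> // n mn pn.
by apply: lmin; rewrite mn pn.
Qed.

Lemma nth_primeS (k : nat) : nth_prime k.+1 = next_prime (nth_prime k).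
Proof. by []. Qed.

Lemma leq_nth_prime (k : nat) : k <= nth_prime k.
Proof.
elim: k => // k kq; have [lt_next _ _] := next_primeP (nth_prime k).
by rewrite nth_primeS (leq_ltn_trans kq).
Qed.

Lemma prime_nth_prime (k : nat) : 0 < k -> prime (nth_prime k).
Proof. by case: k => // k _; have [] := next_primeP (nth_prime k). Qed.

Lemma nth_prime_surj (l : nat) : prime l -> exists2 k, 0 < k & nth_prime k = l.
Proof.
move=> pl; apply/not_exists2P => noidx.
have below k : nth_prime k < l.
  elim: k => [|k kl]; first exact: prime_gt0.
  have [_ _ /(_ l kl pl)] := next_primeP (nth_prime k).
  rewrite -nth_primeS leq_eqVlt => /orP[/eqP kE|//].
  by have [//|] := noidx k.+1; rewrite kE.
by have := below l; rewrite ltnNge leq_nth_prime.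
Qed.

(** * Small gaps between consecutive primes *)

(* Such an n is determined by its valuations at the primes up to Q, each at
   most m. *)
Lemma card_smooth_leq (Q m : nat) :
  \sum_(1 <= n < (2 ^ m).+1) all (leq^~ Q) (primes n) <= m.+1 ^ Q.+1.
Proof.
pose S := [pred n : 'I_(2 ^ m) | all (leq^~ Q) (primes n.+1)].
have -> : \sum_(1 <= n < (2 ^ m).+1) all (leq^~ Q) (primes n) = #|S|.
  by rewrite big_add1 /= big_mkord -sum1_card [RHS]big_mkcond.
pose f (n : 'I_(2 ^ m)) : {ffun 'I_Q.+1 -> 'I_m.+1} :=
  [ffun p : 'I_Q.+1 => inord (logn p n.+1)].
have -> : m.+1 ^ Q.+1 = #|{: {ffun 'I_Q.+1 -> 'I_m.+1}}|.
  by rewrite card_ffun !card_ord.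
rewrite -(card_in_image (f := f) (A := S)); first exact: max_card.
move=> n n' sn sn' fnn'; apply/val_inj/succn_inj/eqn_from_log => // p.
have log_le (r : 'I_(2 ^ m)) : logn p r.+1 <= m.
  have [pp|/negbTE pN] := boolP (prime p); last by rewrite lognE pN.
  rewrite -(@leq_exp2l 2) //; apply: leq_trans (_ : r.+1 <= _) => //.
  apply: leq_trans _ (dvdn_leq (ltn0Sn r) (pfactor_dvdnn p r.+1)).
  have [->|l0] := posnP (logn p r.+1); first by rewrite !expn0.
  by rewrite leq_exp2r ?prime_gt1.
have [pQ|Qp] := leqP p Q.
  move: fnn' => /ffunP/(_ (Ordinal (pQ : p < Q.+1))).
  by rewrite !ffunE /= => /(congr1 val) /=; rewrite !inordK ?ltnS.
have log0 (r : 'I_(2 ^ m)) : all (leq^~ Q) (primes r.+1) -> logn p r.+1 = 0.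
  move=> /allP sr; apply/eqP; rewrite -leqn0 leqNgt logn_gt0.
  by apply/negP => /sr; rewrite leqNgt Qp.
by rewrite !log0.
Qed.

(** The terms are dominated by a geometric series of ratio 5/7 starting at [(5/7) N/a], whose sum is
    [5N/(2a)]. The induction steps from [a] to the next prime, decreasing [N - a]. *)
Lemma sum_primes_gt_leq (Q N : nat) :
  (forall a, prime a -> Q <= a -> 7 * a <= 5 * next_prime a) ->
  forall a, prime a -> Q <= a ->
  2 * a * \sum_(a.+1 <= l < N.+1 | prime l) N %/ l <= 5 * N.
Proof.
move=> gap a; have [n] := ubnP (N - a).
elim: n a => // n IHn a Nan pa Qa.
have [lt_next pnext next_min] := next_primeP a.
have [Nnext|nextN] := ltnP N (next_prime a).
  rewrite big_nat_cond big1 ?muln0 // => l /andP[/andP[al lN] pl].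
  by have := next_min l al pl; rewrite leqNgt (leq_trans lN).
rewrite (@big_cat_nat _ _ _ (next_prime a)) //=; last exact: leqW.
rewrite big_nat_cond big1 ?add0n; last first.
  move=> l /andP[/andP[al lnext] pl].
  by have := next_min l al pl; rewrite leqNgt lnext.
rewrite big_ltn_cond ?ltnS // pnext.
have next_n : N - next_prime a < n by lia.
have := IHn _ next_n pnext (leq_trans Qa (ltnW lt_next)).
have := gap a pa Qa; have := leq_trunc_div N (next_prime a).
move: (next_prime a) (N %/ _) (\sum_(_ <= l < _ | _) _) => a' d T da' gapa IH.
have : 7 * a * (d + T) <= 5 * a' * (d + T) by rewrite leq_mul2r gapa orbT.
lia.
Qed.

Lemma exp_lt_pow2 (Q : nat) : exists m, 2 * m.+1 ^ Q.+1 < 2 ^ m.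
Proof.
(* With [m + 1 = 2^(2i)] both sides are powers of 2, and it remains to compare the exponents
   [2i(Q+1) + 1] and [2^(2i) - 1]. *)
pose i := Q + 3; exists (2 ^ (2 * i)).-1.
rewrite prednK ?expn_gt0 // -expnM -expnS ltn_exp2l //.
have i2 : i < 2 ^ i by apply: ltn_expl.
have ii2 : 2 * i <= 2 ^ i by rewrite /i addn3 expnS leq_mul2l ltn_expl.
have : 2 * i * i.+1 <= 2 ^ (2 * i).
  have -> : 2 ^ (2 * i) = 2 ^ i * 2 ^ i by rewrite -expnD addnn mul2n.
  exact: leq_mul.
by rewrite /i; move: (2 ^ (2 * _)) => E; clear; nia.
Qed.

(* Otherwise the primes beyond Q would grow geometrically, and fewer than half
   of the n <= N = 2^m would have a prime factor beyond Q, whereas only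
   (m+1)^(Q+1) have none. *)
Lemma exists_small_prime_gap (Q : nat) :
  exists a, [/\ prime a, Q <= a & 5 * next_prime a < 7 * a].
Proof.
apply: contrapT => no_gap.
have gap a : prime a -> Q <= a -> 7 * a <= 5 * next_prime a.
  move=> pa Qa; rewrite leqNgt; apply/negP => h.
  by apply: no_gap; exists a.
(* [a > 5] makes the tail bound [5N/(2a)] smaller than [N/2]. *)
have [a Qa pa] := prime_above (Q + 5).
have [m small] := exp_lt_pow2 a.
pose N := 2 ^ m.
have tail := @sum_primes_gt_leq Q N gap a pa (leq_trans (leq_addr 5 Q) (ltnW Qa)).
have smooth := card_smooth_leq a m.
have : N <= \sum_(1 <= n < N.+1) all (leq^~ a) (primes n) +
            \sum_(a.+1 <= l < N.+1 | prime l) N %/ l.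
  (* [N %/ l] counts the multiples of [l] up to [N], so each [n] is counted either as smooth or at a
     prime factor above [a]. *)
  under [X in _ + X]eq_bigr do rewrite divn_count_dvd.
  rewrite exchange_big -big_split /=.
  have one_sum : N = \sum_(1 <= n < N.+1) 1.
    by rewrite sum_nat_const_nat subn1 muln1.
  rewrite [X in X <= _]one_sum big_nat_cond [X in _ <= X]big_nat_cond.
  apply: leq_sum => n /andP[/andP[n0 nN] _].
  case: (boolP (all _ _)) => //= /allPn[l].
  rewrite mem_primes -ltnNge => /and3P[pl _ ln] al.
  have lN : l < N.+1 by apply: leq_ltn_trans nN; apply: dvdn_leq.
  by rewrite (big_rem l) /= ?mem_index_iota ?al // pl ln.
rewrite -/N in small.
move: tail smooth small Qa; rewrite -/N.
move: (\sum_(_ <= _ < _ | _) _) (\sum_(_ <= _ < _) _) (m.+1 ^ _) => T S E.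
nia.
Qed.

(** * Failure of Sun's condition *)

(** The inequality at the first index forces that prime to be 2. At the second, where the prime is
    at least [q_k], it demands exponent of 2 plus 1 [>= q_k - 1], but this exponent is at most
    [q_k - 3]. *)
Lemma special_form_not_sun_condition (L : nat) :
  special_form L -> ~ sun_condition L.
Proof.
move=> [k [b [k0 bp LE]]] [r [P [a [P_inj P_prime LP sunP]]]].
have pp := prime_nth_prime k k0; have pq := prime_nth_prime k.+1 isT.
have [ltpq _ _] := next_primeP (nth_prime k); rewrite -nth_primeS in ltpq.
move: (nth_prime k.+1) (nth_prime k) bp LE pp pq ltpq => q p bp LE pp pq ltpq.
have P_dvd i : P i ^ a i %| L by rewrite LP (bigD1 i) //= dvdn_mulr.
have P_large i : P i != 2 -> p <= P i.
  move=> Pi2; have [Pi_prime a0] := P_prime i.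
  have : P i %| L by apply: dvdn_trans (P_dvd i); rewrite dvdn_exp.
  rewrite LE !Euclid_dvdM // Euclid_dvdX // !dvdn_prime2 // (negbTE Pi2) /=.
  by case/orP=> /eqP -> //; apply: ltnW.
(* The index of [p] differs from the first one, so a second index exists. *)
have [i Pi] : exists i, P i = p.
  have : p %| L by rewrite LE dvdn_mulr // dvdn_mull.
  rewrite LP; elim/big_ind: _ => [|x y IHx IHy|i _].
  - by rewrite dvdn1 => /eqP p1; rewrite p1 in pp.
  - by rewrite Euclid_dvdM // => /orP[].
  - have [Pi_prime _] := P_prime i.
    by rewrite Euclid_dvdX // dvdn_prime2 // => /andP[/eqP pE _]; exists i.
pose o := Ordinal (leq_ltn_trans (leq0n i) (ltn_ord i)).
have P0 : P o = 2.
  have := sunP o; rewrite big_pred0 // => /(leq_trans (leq_addr _ _)).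
  by have [/prime_gt1] := P_prime o; lia.
have i0 : 0 < i.
  rewrite lt0n; apply/eqP => i0; move: Pi; rewrite (_ : i = o) ?P0; first lia.
  exact: val_inj.
pose s := Ordinal (leq_ltn_trans i0 (ltn_ord i)).
have Ps : p <= P s.
  by apply: P_large; rewrite -P0; apply/eqP => /P_inj.
have a0b : a o <= b.
  have L0 : 0 < L by rewrite LE !muln_gt0 expn_gt0 !prime_gt0.
  have := P_dvd o; rewrite P0 pfactor_dvdn // LE -mulnA mulnC logn_Gauss ?pfactorK //.
  by rewrite coprimeMr !prime_coprime // !dvdn_prime2 //; lia.
have := sunP s; rewrite (big_pred1 o) => [|t]; last first.
  by rewrite /= -val_eqE /= ltnS leqn0.
lia.
Qed.

(** * Primitivity and infinitude *)

Lemma primitive_covering_number_2pow_primes (p q : nat) :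
  prime p -> prime q -> 2 < p -> p < q -> 2 * q + 6 <= 3 * p ->
  exists2 b, b + 3 <= p & primitive_covering_number (2 ^ b * p * q).
Proof.
move=> pp pq p2 ltpq small.
have ex_b : exists b, `[< covering_number (2 ^ b * p * q) >].
  by exists (p - 3); apply/asboolP/covering_number_2pow_primes.
case: (ex_minnP ex_b) => b /asboolP covb minb.
have bp : b <= p - 3.
  by apply: minb; apply/asboolP/covering_number_2pow_primes.
have pos : 0 < 2 ^ b * p * q by case: covb.
exists b; first by lia.
split=> // d dL dNL covd.
have [qd|qd] := boolP (q %| d); last first.
  apply: (@not_covering_number_2pow_primeM b p) => //; first by lia.
  apply: covering_number_dvd covd; first by rewrite muln_gt0 expn_gt0 /= prime_gt0.
  by move: dL; rewrite Gauss_dvdl // coprime_sym prime_coprime.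
have [pd|pd] := boolP (p %| d); last first.
  apply: (@not_covering_number_2pow_primeM b q) => //; [by lia..|].
  apply: covering_number_dvd covd; first by rewrite muln_gt0 expn_gt0 /= prime_gt0.
  by move: dL; rewrite mulnAC Gauss_dvdl // coprime_sym prime_coprime.
(* A divisor containing both primes is [2^c p q], and minimality of [b] forces [c = b]. *)
have cpq : coprime p q by rewrite prime_coprime // dvdn_prime2 //; lia.
have : p * q %| d by rewrite Gauss_dvd // pd.
move=> /dvdnP[e dE]; move: dL dNL covd; rewrite dE !mulnA -!(mulnA _ p q).
rewrite dvdn_pmul2r ?muln_gt0 ?prime_gt0 //.
move=> /(dvdn_pfactor _ _ (isT : prime 2))[c cb ->] dNL covd.
move: dNL; rewrite (_ : c = b) ?eqxx //; apply/eqP; rewrite eqn_leq cb minb //.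
by apply/asboolP; rewrite -mulnA.
Qed.

Theorem theorem4 (delta : int) (delta_ge3 : (3%:Z <= delta)%R) :
  [/\ infinite_set
        [set L : nat | primitive_covering_number L /\ special_form L]%classic,
      forall L : nat, primitive_covering_number L -> special_form L ->
        ~ sun_condition L
    & ~ sun_conjecture].
Proof.
set S := [set L : nat | _]%classic.
have unbounded n : exists2 L, S L & n <= L.
  (* From [5q < 7p] and [p >= 30] follows [2q + 6 < 14p/5 + p/5 = 3p]. *)
  have [p [pp np gap]] := exists_small_prime_gap (n + 30).
  have [ltpq pq _] := next_primeP p.
  have [b bp prim] : exists2 b, b + 3 <= p &
      primitive_covering_number (2 ^ b * p * next_prime p).
    by apply: primitive_covering_number_2pow_primes => //; lia.
  have [k k0 kp] := nth_prime_surj p pp.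
  exists (2 ^ b * p * next_prime p).
    by split=> //; exists k, b; rewrite nth_primeS kp.
  have : p <= 2 ^ b * p * next_prime p.
    by rewrite mulnAC leq_pmull // muln_gt0 expn_gt0 /= prime_gt0.
  lia.
have not_sun L : primitive_covering_number L -> special_form L ->
    ~ sun_condition L.
  by move=> _; apply: special_form_not_sun_condition.
split=> //.
  rewrite finite_seqP => -[s sE].
  have [L SL sL] := unbounded (\max_(m <- s) m).+1.
  move: SL; rewrite sE /= => Ls.
  by move: sL; rewrite (big_rem L) //= ltnNge leq_maxl.
by move=> sun; have [L [prim spec] _] := unbounded 0; apply: (not_sun L) (sun _ _).
Qed.
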